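(* Let $\mathbf{c}_0$ be a binary initial configuration on the directed path $P_n$ with $|\mathbf{c}_0|>1$, and let $1\le k\le n$. If the set of non-zero positions of $\mathbf{c}_0$ is exactly $$[i]_k=\{\,j : j\equiv i \ (\mathrm{mod}\ k),\ 1\le j\le n\,\}\quad\text{for some } 1\le i\le n,$$ then $\mathcal{A}(P_n,\mathbf{c}_0)$ is homotopy equivalent to $k$ disconnected points (a discrete space with $k$ points).
   Context: $P_n$ is the directed path with vertices $v_1,\dots,v_{n+1}$ and edges $(v_i,v_{i+1})$ for $i=1,\dots,n$. The vertex $v_{n+1}$ is a sink: it never fires, absorbs grains, and is not included in configurations or in the avalanche complex. A configuration is a vector $\mathbf{c}\in\mathbb{N}^n$ ($0\in\mathbb{N}$), where $\mathbf{c}(v_i)$ is the number of grains on $v_i$ (position $i$), $1\le i\le n$; it is binary if every entry is $0$ or $1$; $|\mathbf{c}|$ is the sum of its entries. Parallel-firing sandpile dynamics started from $\mathbf{c}_0$: at each time $t=0,1,2,\dots$ the firing set $\sigma_t$ is the set of $v_i$, $1\le i\le n$, with $\mathbf{c}_t(v_i)\ge 1$; all of these fire simultaneously, each sending one grain to $v_{i+1}$, so that $\mathbf{c}_{t+1}(v_i)=\mathbf{c}_t(v_i)-[v_i\in\sigma_t]+[v_{i-1}\in\sigma_t]$ for $1\le i\le n$ (where $[\cdot]$ around a condition is $1$ if it holds and $0$ otherwise, and the last term is $0$ for $i=1$). The avalanche complex $\mathcal{A}(P_n,\mathbf{c}_0)$ is the simplicial complex generated by the firing sets, i.e. the simplices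 are all nonempty subsets of the sets $\sigma_t$, $t\ge 0$ (vertices that never fire are not vertices of the complex). *)

(* Defs.v *)
From HB Require Import structures.
From mathcomp Require Import all_boot all_order all_algebra.
From mathcomp Require Import all_classical all_reals.
From mathcomp Require Import topology normedtype.

Set Implicit Arguments.
Unset Strict Implicit.
Unset Printing Implicit Defensive.

Import Order.TTheory GRing.Theory Num.Theory.
Import numFieldNormedType.Exports.

Local Open Scope classical_set_scope.
Local Open Scope ring_scope.

(* The index [j : 'I_n] stands for the vertex v_(j+1), whose position is
   [j.+1]; the sink v_(n+1) carries no index. *)
Definition config (n : nat) := {ffun 'I_n -> nat}.

Definition position (n : nat) (j : 'I_n) : nat := j.+1.

Definition binary (n : nat) (c : config n) : Prop := forall j, (c j <= 1)%N.

Definition grains (n : nat) (c : config n) : nat := (\sum_(j < n) c j)%N.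

Definition nonzero_positions (n : nat) (c : config n) : {set 'I_n} :=
  [set j | c j != 0%N]%SET.

Definition residue_class (n k i : nat) : {set 'I_n} :=
  [set j : 'I_n | position j == i %[mod k]]%SET.

Definition firing_set (n : nat) (c : config n) : {set 'I_n} :=
  [set j | (1 <= c j)%N]%SET.

(* The truncated subtraction is exact: a firing vertex has at least one grain. *)
Definition fire (n : nat) (c : config n) : config n :=
  [ffun j => (c j - (j \in firing_set c)
              + [exists l in firing_set c, position j == (position l).+1])%N].

Definition config_at (n : nat) (c0 : config n) (t : nat) : config n :=
  iter t (@fire n) c0.

(* Singletons are not required to be simplices: the elements of [V] that belong
   to no simplex are not vertices of the complex. *)
Record simplicial_complex (V : finType) := SimplicialComplex {
  simplices : set {set V};
  simplex_neq0 : forall s, simplices s -> s != finset.set0;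
  simplex_sub : forall s t : {set V},
    simplices s -> t != finset.set0 -> t \subset s -> simplices t }.

Section GeneratedComplex.
Variables (V : finType) (G : set {set V}).

Definition generated_simplices : set {set V} :=
  [set t | t != finset.set0 /\ exists2 s, G s & t \subset s].

Lemma generated_simplex_neq0 s : generated_simplices s -> s != finset.set0.
Proof. by case. Qed.

Lemma generated_simplex_sub (s t : {set V}) :
  generated_simplices s -> t != finset.set0 -> t \subset s ->
  generated_simplices t.
Proof.
move=> [_ [u Gu su]] t0 ts; split=> //; exists u => //.
exact: fintype.subset_trans ts su.
Qed.

Definition generated_complex : simplicial_complex V :=
  SimplicialComplex generated_simplex_neq0 generated_simplex_sub.

End GeneratedComplex.

Definition avalanche_complex (n : nat) (c0 : config n) :
    simplicial_complex 'I_n :=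
  generated_complex (range (fun t => firing_set (config_at c0 t))).

(* [x ord0 v] is the barycentric coordinate of [x] at [v]. *)
Definition realization_points (R : realType) (n : nat)
    (K : simplicial_complex 'I_n) : set 'rV[R]_n :=
  [set x | [/\ forall v, 0 <= x ord0 v,
               \sum_v x ord0 v = 1 &
               simplices K [set v | x ord0 v != 0]%SET]].

Arguments realization_points R {n} K.

(* The topology is the one induced by R^n; as the complex is finite, it agrees
   with the weak (coherent) topology. *)
Definition geometric_realization (R : realType) (n : nat)
    (K : simplicial_complex 'I_n) : topologicalType :=
  set_type (realization_points R K).

Arguments geometric_realization R {n} K.

(* [H] is only constrained on X x [0, 1]. *)
Definition homotopic (R : realType) (X Y : topologicalType) (f g : X -> Y) :=
  exists H : X * R -> Y,
    [/\ {within [set: X] `*` `[0, 1], continuous H},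
        forall x, H (x, 0) = f x &
        forall x, H (x, 1) = g x].

Definition homotopy_equivalent (R : realType) (X Y : topologicalType) :=
  exists (f : X -> Y) (g : Y -> X),
    [/\ continuous f, continuous g,
        homotopic R (g \o f) idfun &
        homotopic R (f \o g) idfun].

(* Main.v *)
Require Import Defs.
From HB Require Import structures.
From mathcomp Require Import all_boot all_order all_algebra.
From mathcomp Require Import all_classical all_reals.
From mathcomp Require Import topology normedtype.
From mathcomp Require Import zify.

(** A binary configuration on a directed path is translated by one position at
    each time step, because every grain moves and no two grains ever meet
    ([firing_set_config_at]).  When the grains initially occupy the whole class
    of [i] modulo [k], the firing set at time [t] therefore consists of the
    positions [p] with [t < p <= n] and [p = i + t] modulo [k]
    ([mem_firing_set_residue]).

    Hence the firing set at time [t] is contained in the one at time [t %% k],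
    and the firing sets at times [0, ..., k - 1] lie in different residue
    classes, so they are pairwise disjoint.  They are also non-empty: two grains
    of the same class are at least [k] apart, so the first one needs at least
    [k] steps to reach the sink.  The complex is thus a disjoint union of [k]
    full simplices.

    Such a complex has the homotopy type of [k] points
    ([homotopy_equivalent_disjoint_simplices]): the map that names the simplex
    containing a point is locally constant, and the straight-line homotopy
    contracts each simplex onto one of its vertices. *)

Set Implicit Arguments.
Unset Strict Implicit.
Unset Printing Implicit Defensive.

Import Order.TTheory GRing.Theory Num.Theory.
Import numFieldNormedType.Exports.

Local Open Scope classical_set_scope.
Local Open Scope ring_scope.

(** * Translation of the grains *)

Section Dynamics.
Variables (n : nat) (c0 : config n).
Hypothesis c0_binary : binary c0.

(** On a binary configuration a firing vertex loses its only grain, so what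
    remains at [j] is exactly what arrives from the preceding vertex; in
    particular the configuration stays binary. *)
Lemma fire_binary (c : config n) (j : 'I_n) : binary c ->
  fire c j = [exists l in firing_set c, position j == (position l).+1] :> nat.
Proof.
move=> cb; rewrite ffunE inE; have := cb j.
by case: (c j) => [|[|//]] _; rewrite ?subn0 ?subnn.
Qed.

Lemma binary_config_at t : binary (config_at c0 t).
Proof.
by elim: t => [//|t IHt] j; rewrite [config_at _ _]/= fire_binary // leq_b1.
Qed.

(** Each step translates the firing set by one position, by [fire_binary];
    the grains pushed beyond the last vertex have been absorbed by the sink. *)
Lemma firing_set_config_at t j :
  (j \in firing_set (config_at c0 t)) =
  [exists l in firing_set c0, position j == (position l + t)%N].
Proof.
elim: t j => [|t IHt] j.
  apply/idP/exists_inP => [jc|[l lc /eqP/eqP]]; first by exists j; rewrite // addn0.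
  by rewrite addn0 eqSS => /eqP/val_inj->.
rewrite inE fire_binary; last exact: binary_config_at.
rewrite lt0b; apply/exists_inP/exists_inP => [[l]|[l lc]].
  by rewrite IHt => /exists_inP[m mc /eqP ->] jm; exists m; rewrite // addnS.
rewrite addnS => /eqP jl.
have ltn : (l + t < n)%N by have := ltn_ord j; rewrite /position in jl; lia.
exists (Ordinal ltn); last by rewrite jl.
by rewrite IHt; apply/exists_inP; exists l.
Qed.

(** The index [j] stands for the position [j + 1], so [t <= j] says that [j]
    is the translate by [t] of a position that is at least [1]. *)
Lemma mem_firing_set_residue k i t (j : 'I_n) :
  nonzero_positions c0 = residue_class n k i ->
  reflect ((t <= j)%N /\ position j = i + t %[mod k])%N
          (j \in firing_set (config_at c0 t)).
Proof.
move=> supp; rewrite firing_set_config_at.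
have memc l : (l \in firing_set c0) = (position l == i %[mod k])%N.
  by rewrite inE lt0n; move/setP/(_ l): supp; rewrite !inE.
apply: (iffP exists_inP) => [[l]|[tj jk]].
  rewrite memc => /eqP lk /eqP jl; split; first by rewrite /position in jl; lia.
  by rewrite jl -modnDml lk modnDml.
have ltn : (j - t < n)%N by have := ltn_ord j; lia.
exists (Ordinal ltn); last by rewrite /position /=; lia.
rewrite memc -(eqn_modDr t) -jk; apply/eqP; congr (_ %% _)%N.
by rewrite /position /=; lia.
Qed.

Lemma binary_grains : grains c0 = #|firing_set c0|.
Proof.
rewrite /grains -sum1_card [RHS]big_mkcond; apply: eq_bigr => j _.
by rewrite inE; have := c0_binary j; case: (c0 j) => [|[]].
Qed.

End Dynamics.

(** * Disjoint unions of full simplices *)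

Section DisjointSimplices.
Variables (R : realType) (n k : nat) (K : simplicial_complex 'I_n).
Variable B : 'I_k -> {set 'I_n}.

Let supp (x : 'rV[R]_n) : {set 'I_n} := [set v | x ord0 v != 0]%SET.

(** On a segment between two points carried by the same simplex, all
    coordinates outside that simplex vanish. *)
Lemma realization_segment (x y : 'rV[R]_n) s (t : R) :
  realization_points R K x -> realization_points R K y ->
  simplices K s -> supp x \subset s -> supp y \subset s -> 0 <= t <= 1 ->
  realization_points R K ((1 - t) *: x + t *: y).
Proof.
move=> [x0 x1 _] [y0 y1 _] Ks /fintype.subsetP xs /fintype.subsetP ys /andP[t0 t1].
set z := _ + _.
have z1 : \sum_v z ord0 v = 1.
  under eq_bigr do rewrite !mxE.
  by rewrite big_split -!mulr_sumr /= x1 y1 !mulr1 subrK.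
split=> // [v|].
  by rewrite !mxE addr_ge0 // mulr_ge0 // subr_ge0.
apply: (simplex_sub Ks).
(* The support is non-empty because the coordinates sum to [1]. *)
- apply/eqP => z_eq0; suff : \sum_v z ord0 v = 0 by rewrite z1 => /eqP; rewrite oner_eq0.
  apply: big1 => v _; have : v \notin supp z by rewrite [supp z]z_eq0 inE.
  by rewrite inE negbK => /eqP.
- apply/fintype.subsetP => v; apply: contraLR => vs.
  have /eqP xv : x ord0 v == 0.
    by have := contraNN (@xs v) vs; rewrite inE negbK.
  have /eqP yv : y ord0 v == 0.
    by have := contraNN (@ys v) vs; rewrite inE negbK.
  by rewrite inE negbK !mxE xv yv !mulr0 addr0.
Qed.

Lemma realization_vertex v : simplices K [set v]%SET ->
  realization_points R K (delta_mx ord0 v).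
Proof.
move=> Kv; split=> [w||].
- by rewrite mxE; case: (_ && _).
- rewrite (bigD1 v) //= mxE !eqxx big1 ?addr0 // => w /negPf wv.
  by rewrite mxE wv andbF.
- congr (simplices K _): Kv; apply/setP => w; rewrite !inE mxE eqxx /=.
  by case: (w == v); rewrite ?oner_eq0 ?eqxx.
Qed.

(* [K] is the disjoint union of the full simplices [B a]. *)
Hypothesis B_neq0 : forall a, B a != finset.set0.
Hypothesis B_disjoint : forall a b v, v \in B a -> v \in B b -> a = b.
Hypothesis KE : forall s, simplices K s <->
  s != finset.set0 /\ exists a, s \subset B a.

Local Notation X := (geometric_realization R K).

Let point (x : 'rV[R]_n) (Kx : realization_points R K x) : X :=
  exist _ x (mem_set Kx).

(** The support of a point of the realization lies in a unique [B a]; this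
    index [a] defines the map to ['I_k].  The map in the other direction sends
    [a] to a chosen vertex of [B a]: one composite is the identity, and the
    other contracts each simplex onto its chosen vertex along segments. *)
Lemma homotopy_equivalent_disjoint_simplices :
  homotopy_equivalent R X (discrete_topology 'I_k).
Proof.
have KB a : simplices K (B a) by apply/KE; split=> //; exists a.
have XP (x : X) : realization_points R K (set_val x) by apply: set_valP.
have /choice[f fP] (x : X) : exists a, supp (set_val x) \subset B a.
  by have [_ _ /KE[]] := XP x.
have supp_neq0 (x : X) : exists v, v \in supp (set_val x).
  by have [_ _ /simplex_neq0/set0Pn] := XP x.
have /choice[rep repP] a : exists v, v \in B a by apply/set0Pn.
have Krep a : simplices K [set rep a]%SET.
  apply/KE; split; last by exists a; rewrite finset.sub1set.
  by apply/set0Pn; exists (rep a); rewrite inE.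
pose g a : X := point (realization_vertex (Krep a)).
have supp_g a : supp (set_val (g a)) \subset B a.
  apply/fintype.subsetP => w; rewrite inE mxE eqxx /=.
  by have [->|] := eqVneq w (rep a); rewrite ?eqxx.
have fgK a : f (g a) = a.
  have [v vg] := supp_neq0 (g a).
  by apply: (@B_disjoint _ _ v); [exact: (fintype.subsetP (fP _))|exact: (fintype.subsetP (supp_g a))].
have val_cts : continuous (set_val : X -> 'rV[R]_n) by apply: initial_continuous.
have f_cts : continuous (f : X -> discrete_topology 'I_k).
  move=> x A fxA.
  have [v vx] := supp_neq0 x.
  (* A vertex [v] in the support of [x] remains in the support of every nearby
     point [y], which forces [y] into the same simplex as [x]. *)
  have xv : nbhs x [set y : X | set_val y ord0 v != 0].
    have cv : {for x, continuous (fun y : X => set_val y ord0 v)}.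
      apply: (@continuous_comp _ _ _ set_val (fun M : 'rV[R]_n => M ord0 v)).
        exact: val_cts.
      exact: coord_continuous.
    apply: (cv [set r | r != 0]); apply: open_nbhs_nbhs; split; first exact: open_neq.
    by move: vx; rewrite inE.
  apply: filterS xv => y yv.
  have fxy : f x = f y.
    apply: (@B_disjoint _ _ v); apply: (fintype.subsetP (fP _)) => //.
    by rewrite inE.
  by rewrite /preimage /= -fxy; exact: (nbhs_singleton fxA).
have g_cts : continuous (g : discrete_topology 'I_k -> X).
  by move=> a A gaA; apply/principal_filterP; exact: (nbhs_singleton gaA).
exists f, g; split=> //.
(* Clamping the time to [0, 1] keeps the segment inside the simplex, so that the
   homotopy is defined and continuous for all real times. *)
- pose s (r : R) : R := Num.min (Num.max r 0) 1.
  have s01 r : 0 <= s r <= 1.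
    by rewrite /s le_min ler01 !ge_min lexx orbT le_max lexx !orbT.
  have s_cts : continuous s.
    move=> r; apply: (@continuous_min R R (fun r => Num.max r 0) (cst 1)).
      by apply: (@continuous_max R R id (cst 0)); [exact: cvg_id|exact: cvg_cst].
    exact: cvg_cst.
  pose H (p : X * R) : X := point (realization_segment
    (XP (g (f p.1))) (XP p.1) (KB (f p.1)) (supp_g _) (fP _) (s01 p.2)).
  exists H; split=> [|x|x].
  + apply: continuous_subspaceT; apply: continuous_comp_initial => p.
    have s2_cvg : s q.2 @[q --> p] --> s p.2.
      by apply: continuous_comp; [exact: cvg_snd|exact: s_cts].
    have x_cvg : set_val q.1 @[q --> p] --> set_val p.1.
      by apply: continuous_comp; [exact: cvg_fst|exact: val_cts].
    have gfx_cvg : set_val (g (f q.1)) @[q --> p] --> set_val (g (f p.1)).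
      apply: (@continuous_comp _ _ _ (fun q : X * R => q.1) (set_val \o (g \o f))).
        exact: cvg_fst.
      apply: continuous_comp; last exact: val_cts.
      apply: (@continuous_comp _ (discrete_topology 'I_k) _ f g).
        exact: f_cts.
      exact: g_cts.
    apply: cvgD; apply: cvgZ => //; apply: cvgB => //; exact: cvg_cst.
  + apply: val_inj => /=.
    by rewrite /s maxxx min_l ?ler01 // subr0 scale1r scale0r addr0.
  + apply: val_inj => /=.
    by rewrite /s max_l ?ler01 // minxx subrr scale1r scale0r add0r.
- exists (fun p => p.1); split=> [|a|//]; last exact: esym (fgK a).
  by apply: continuous_subspaceT => p; apply: cvg_fst.
Qed.
End DisjointSimplices.

(** * The avalanche complex of a residue class *)

Theorem lemma3p7 (R : realType) (n : nat) (c0 : config n) (k i : nat)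
    (c0_binary : binary c0) (c0_grains : (1 < grains c0)%N)
    (k_range : (1 <= k <= n)%N) (i_range : (1 <= i <= n)%N)
    (c0_support : nonzero_positions c0 = residue_class n k i) :
  homotopy_equivalent R
    (geometric_realization R (avalanche_complex c0))
    (discrete_topology 'I_k).
Proof.
have k_gt0 : (0 < k)%N by case/andP: k_range.
have sigmaP t j := @mem_firing_set_residue n c0 c0_binary k i t j c0_support.
apply: (@homotopy_equivalent_disjoint_simplices R n k (avalanche_complex c0)
          (fun a => firing_set (config_at c0 a))).
- move=> a.
  have [l1 [l2 [l1c l2c l12]]] : exists l1 l2 : 'I_n,
      [/\ l1 \in firing_set c0, l2 \in firing_set c0 & (l1 < l2)%N].
    move: c0_grains; rewrite binary_grains // => /card_gt1P[x [y [xc yc]]].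
    by rewrite neq_ltn => /orP[xy|yx]; [exists x, y|exists y, x].
  have /(sigmaP 0)[_ l1k] := l1c; have /(sigmaP 0)[_ l2k] := l2c.
  have l1k2 : (l1 + k <= l2)%N.
    (* Distinct positions of one class modulo [k] differ by at least [k]. *)
    have /eqP := etrans l2k (esym l1k).
    rewrite eqn_mod_dvd ?leqS // => [/dvdn_leq|]; rewrite /position; lia.
  have ltn : (l1 + a < n)%N by have := ltn_ord a; have := ltn_ord l2; lia.
  apply/set0Pn; exists (Ordinal ltn); apply/sigmaP; split; first exact: leq_addl.
  by rewrite -[in RHS]modnDml -[i]addn0 -l1k modnDml.
- move=> a b v /sigmaP[_ ak] /sigmaP[_ bk]; apply: val_inj => /=.
  have /eqP : i + a = i + b %[mod k] by rewrite -ak.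
  by rewrite eqn_modDl !modn_small // => /eqP.
- (* The firing sets at times [t >= k] add no simplex: each is contained in the
     one at time [t %% k]. *)
  move=> s; split=> [[s0 [_ [t _ <-] st]]|[s0 [a sa]]]; split=> //.
    have ltk : (t %% k < k)%N by rewrite ltn_mod.
    exists (Ordinal ltk); apply: (fintype.subset_trans st).
    apply/fintype.subsetP => j /sigmaP[tj jk]; apply/sigmaP; split.
      exact: leq_trans (leq_mod _ _) tj.
    by rewrite modnDmr.
  by exists (firing_set (config_at c0 a)) => //; exists a.
Qed.
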